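(* Let $\kappa:\mathbb{R}^n\to\mathbb{R}\cup\{+\infty\}$ and $\rho:\mathbb{R}^m\to\mathbb{R}\cup\{+\infty\}$ be closed gauges, $A:\mathbb{R}^n\to\mathbb{R}^m$ linear, $b\in\mathbb{R}^m$, $\sigma\ge0$, with $\rho(b)>\sigma$. Suppose that the gauge dual $(G_d)$ is relatively strictly feasible and the gauge primal $(G_p)$ is feasible. Let $(L_p)$ denote the Lagrange (Fenchel–Rockafellar) dual of $(G_d)$, and let $\nu_L$ denote its optimal value. Then, for $z^*\in\mathbb{R}^n$, $$z^*\text{ is optimal for }(L_p)\iff z^*/\nu_L\text{ is optimal for }(G_p).$$
   Context: A gauge is a convex function into $\mathbb{R}\cup\{+\infty\}$ that is nonnegative, positively homogeneous, and vanishes at the origin; closed means lower semicontinuous. The polar of a gauge $\kappa$ is $\kappa^\circ(y)=\inf\{\mu>0\mid\langle x,y\rangle\le\mu\kappa(x)\ \forall x\}$ (with $\inf\emptyset=+\infty$). $\operatorname{dom}h=\{h<+\infty\}$, and $\delta_C$ is the $0/{+\infty}$ indicator of $C$. Problems: $(G_p)$: minimize $\kappa(x)$ subject to $\rho(b-Ax)\le\sigma$. $(G_d)$: minimize $\kappa^\circ(A^Ty)$ subject to $\langle b,y\rangle-\sigma\rho^\circ(y)\ge1$. Convention: when $\sigma=0$, $\sigma\rho^\circ$ means $\delta_{\operatorname{cl}\operatorname{dom}\rho^\circ}$. Feasible sets: $\mathcal{F}_p=\{u\mid\rho(b-u)\le\sigma\}$, $\mathcal{F}_d=\{y\mid\langle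 b,y\rangle-\sigma\rho^\circ(y)\ge1\}$. $(G_p)$ is feasible if $A^{-1}\mathcal{F}_p\cap\operatorname{dom}\kappa\neq\emptyset$; $(G_d)$ is relatively strictly feasible if $A^T(\operatorname{ri}\mathcal{F}_d)\cap\operatorname{ri}\operatorname{dom}\kappa^\circ\ne\emptyset$. The Lagrange dual $(L_p)$ of $(G_d)$ is the Fenchel–Rockafellar dual associated with the perturbation $\Phi(y,w)=\kappa^\circ(A^Ty+w)+\delta_{\mathcal{F}_d}(y)$, $w\in\mathbb{R}^n$, of the objective: $(L_p)$ is to maximize $-\Phi^\star(0,z)$ over $z\in\mathbb{R}^n$, where $\Phi^\star$ is the Fenchel conjugate. Explicitly, $(L_p)$ is: maximize $\inf_{y\in\mathcal{F}_d}\langle z,A^Ty\rangle$ over $z$ subject to $\kappa(z)\le1$. *)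

(* Defs.v *)
From mathcomp Require Export all_boot all_order all_algebra.
From mathcomp Require Export all_classical all_reals all_analysis.
Export Order.TTheory GRing.Theory Num.Theory.
Export numFieldNormedType.Exports.

Set Implicit Arguments.
Unset Strict Implicit.
Unset Printing Implicit Defensive.

Local Open Scope classical_set_scope.
Local Open Scope ring_scope.
Local Open Scope ereal_scope.

Definition dotp (R : realType) (k : nat) (x y : 'cV[R]_k) : R :=
  (\sum_(i < k) x i ord0 * y i ord0)%R.

Definition dom (R : realType) (k : nat) (h : 'cV[R]_k -> \bar R) :
    set 'cV[R]_k :=
  [set x | h x < +oo].

Definition indicator (R : realType) (k : nat) (C : set 'cV[R]_k)
    (x : 'cV[R]_k) : \bar R :=
  if `[< C x >] then 0 else +oo.

Definition convex_efun (R : realType) (k : nat) (h : 'cV[R]_k -> \bar R) :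
    Prop :=
  forall (t : R) (x y : 'cV[R]_k), (0 < t < 1)%R ->
    h ((1 - t) *: x + t *: y)%R <= (1 - t)%:E * h x + t%:E * h y.

(* Nonnegativity excludes the value -oo, so a gauge takes its values in
   the reals extended by +oo only. *)
Record gauge (R : realType) (k : nat) (h : 'cV[R]_k -> \bar R) : Prop := {
  gauge_convex : convex_efun h;
  gauge_ge0 : forall x, 0 <= h x;
  gauge_homogeneous : forall (t : R) x, (0 < t)%R -> h (t *: x)%R = t%:E * h x;
  gauge0 : h 0%R = 0 }.

Definition closed_gauge (R : realType) (k : nat) (h : 'cV[R]_k -> \bar R) :
    Prop :=
  gauge h /\ lower_semicontinuous h.

Definition polar (R : realType) (k : nat) (h : 'cV[R]_k -> \bar R)
    (y : 'cV[R]_k) : \bar R :=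
  ereal_inf [set mu%:E | mu in
    [set mu : R | (0 < mu)%R /\ forall x, (dotp x y)%:E <= mu%:E * h x]].

Definition affine_set (R : realType) (k : nat) (M : set 'cV[R]_k) : Prop :=
  forall (t : R) (x y : 'cV[R]_k), M x -> M y -> M ((1 - t) *: x + t *: y)%R.

Definition affine_hull (R : realType) (k : nat) (C : set 'cV[R]_k) :
    set 'cV[R]_k :=
  [set x | forall M, affine_set M -> C `<=` M -> M x].

Definition relint (R : realType) (k : nat) (C : set 'cV[R]_k) :
    set 'cV[R]_k :=
  [set x | C x /\ \forall y \near x, affine_hull C y -> C y].

(* Fenchel conjugate of a function on R^m x R^n, taken jointly in both
   arguments. *)
Definition conjugate2 (R : realType) (m n : nat)
    (Phi : 'cV[R]_m -> 'cV[R]_n -> \bar R)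
    (v : 'cV[R]_m) (z : 'cV[R]_n) : \bar R :=
  ereal_sup [set (dotp v p.1 + dotp z p.2)%:E - Phi p.1 p.2 |
             p in [set: 'cV[R]_m * 'cV[R]_n]].

(* sigma times the polar of rho, which at sigma = 0 means by convention the
   indicator of cl dom (polar rho); it differs there from 0%:E * polar rho y. *)
Definition scaled_polar (R : realType) (m : nat) (sigma : R)
    (rho : 'cV[R]_m -> \bar R) (y : 'cV[R]_m) : \bar R :=
  if sigma == 0%R then indicator (closure (dom (polar rho))) y
  else sigma%:E * polar rho y.

Definition Fp (R : realType) (m : nat) (rho : 'cV[R]_m -> \bar R)
    (b : 'cV[R]_m) (sigma : R) : set 'cV[R]_m :=
  [set u | rho (b - u)%R <= sigma%:E].

Definition Fd (R : realType) (m : nat) (rho : 'cV[R]_m -> \bar R)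
    (b : 'cV[R]_m) (sigma : R) : set 'cV[R]_m :=
  [set y | 1 <= (dotp b y)%:E - scaled_polar sigma rho y].

Definition Gp_feasible_set (R : realType) (m n : nat)
    (kappa : 'cV[R]_n -> \bar R) (rho : 'cV[R]_m -> \bar R)
    (A : 'M[R]_(m, n)) (b : 'cV[R]_m) (sigma : R) : set 'cV[R]_n :=
  [set x | Fp rho b sigma (A *m x)] `&` dom kappa.

Definition Gp_feasible (R : realType) (m n : nat)
    (kappa : 'cV[R]_n -> \bar R) (rho : 'cV[R]_m -> \bar R)
    (A : 'M[R]_(m, n)) (b : 'cV[R]_m) (sigma : R) : Prop :=
  Gp_feasible_set kappa rho A b sigma !=set0.

Definition Gp_optimal (R : realType) (m n : nat)
    (kappa : 'cV[R]_n -> \bar R) (rho : 'cV[R]_m -> \bar R)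
    (A : 'M[R]_(m, n)) (b : 'cV[R]_m) (sigma : R) (x : 'cV[R]_n) : Prop :=
  Gp_feasible_set kappa rho A b sigma x /\
  forall x', Gp_feasible_set kappa rho A b sigma x' -> kappa x <= kappa x'.

Definition Gd_relatively_strictly_feasible (R : realType) (m n : nat)
    (kappa : 'cV[R]_n -> \bar R) (rho : 'cV[R]_m -> \bar R)
    (A : 'M[R]_(m, n)) (b : 'cV[R]_m) (sigma : R) : Prop :=
  [set A^T *m y | y in relint (Fd rho b sigma)]
    `&` relint (dom (polar kappa)) !=set0.

Definition Gd_perturbation (R : realType) (m n : nat)
    (kappa : 'cV[R]_n -> \bar R) (rho : 'cV[R]_m -> \bar R)
    (A : 'M[R]_(m, n)) (b : 'cV[R]_m) (sigma : R)
    (y : 'cV[R]_m) (w : 'cV[R]_n) : \bar R :=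
  polar kappa (A^T *m y + w)%R + indicator (Fd rho b sigma) y.

Definition Lp_objective (R : realType) (m n : nat)
    (kappa : 'cV[R]_n -> \bar R) (rho : 'cV[R]_m -> \bar R)
    (A : 'M[R]_(m, n)) (b : 'cV[R]_m) (sigma : R) (z : 'cV[R]_n) : \bar R :=
  - conjugate2 (Gd_perturbation kappa rho A b sigma) 0%R z.

Definition Lp_value (R : realType) (m n : nat)
    (kappa : 'cV[R]_n -> \bar R) (rho : 'cV[R]_m -> \bar R)
    (A : 'M[R]_(m, n)) (b : 'cV[R]_m) (sigma : R) : \bar R :=
  ereal_sup (range (Lp_objective kappa rho A b sigma)).

(* Infeasible points of the maximization problem are those with value -oo. *)
Definition Lp_optimal (R : realType) (m n : nat)
    (kappa : 'cV[R]_n -> \bar R) (rho : 'cV[R]_m -> \bar R)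
    (A : 'M[R]_(m, n)) (b : 'cV[R]_m) (sigma : R) (z : 'cV[R]_n) : Prop :=
  -oo < Lp_objective kappa rho A b sigma z /\
  forall z', Lp_objective kappa rho A b sigma z'
             <= Lp_objective kappa rho A b sigma z.

(* Main.v *)
Require Import Defs.
From mathcomp Require Import ring lra.

(* Write F_p and F_d for the feasible sets. By separation, F_d is the antipolar of
   F_p, and u lies in the antipolar of F_d only if s u lies in F_p for some
   0 < s <= 1. So if z has Lagrange objective at least l > 0, then (s / l) z is
   feasible for (G_p), with kappa-value at most s / l, for some such s; conversely
   a feasible x of (G_p) gives z = x / kappa(x) with objective at least
   1 / kappa(x). Hence nu_L = 1 / inf (G_p), without any strong duality theorem;
   feasibility of (G_d) makes inf (G_p) positive. If z is optimal for (L_p), then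
   minimality of inf (G_p) forces s = 1 at l = nu_L, so z / nu_L is itself feasible. *)

Set Implicit Arguments.
Unset Strict Implicit.
Unset Printing Implicit Defensive.

Local Open Scope classical_set_scope.
Local Open Scope ring_scope.

(** * Inner product on column vectors and compactness of boxes *)

Section inner_product.
Variables (R : realType) (k : nat).
Implicit Types x y z : 'cV[R]_k.

Lemma dotpC x y : dotp x y = dotp y x.
Proof. by apply: eq_bigr => i _; rewrite mulrC. Qed.

Lemma dotpDl x y z : dotp (x + y) z = dotp x z + dotp y z.
Proof.
by rewrite /dotp -big_split; apply: eq_bigr => i _; rewrite mxE mulrDl.
Qed.

Lemma dotpZl (t : R) x z : dotp (t *: x) z = t * dotp x z.
Proof. by rewrite /dotp mulr_sumr; apply: eq_bigr => i _; rewrite mxE mulrA. Qed.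

Lemma dotpNl x z : dotp (- x) z = - dotp x z.
Proof. by rewrite -scaleN1r dotpZl mulN1r. Qed.

Lemma dotp0l z : dotp 0 z = 0.
Proof. by rewrite -(scale0r z) dotpZl mul0r. Qed.

Lemma dotpDr x y z : dotp z (x + y) = dotp z x + dotp z y.
Proof. by rewrite dotpC dotpDl !(dotpC z). Qed.

Lemma dotpZr (t : R) x z : dotp z (t *: x) = t * dotp z x.
Proof. by rewrite dotpC dotpZl (dotpC z). Qed.

Lemma dotpNr x z : dotp z (- x) = - dotp z x.
Proof. by rewrite dotpC dotpNl (dotpC z). Qed.

Lemma dotp0r z : dotp z 0 = 0.
Proof. by rewrite dotpC dotp0l. Qed.

Lemma sqr_coord_le_dotp x i : x i ord0 ^+ 2 <= dotp x x.
Proof.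
rewrite /dotp (bigD1 i) //= expr2 lerDl sumr_ge0 // => j _.
by rewrite -expr2 sqr_ge0.
Qed.

Lemma dotp_ge0 x : 0 <= dotp x x.
Proof. by apply: sumr_ge0 => i _; rewrite -expr2 sqr_ge0. Qed.

Lemma dotp_gt0 x : x != 0 -> 0 < dotp x x.
Proof.
move=> x0; rewrite lt_neqAle dotp_ge0 andbT; apply: contra_neq x0 => xx.
apply/colP => i; rewrite mxE; apply/eqP; rewrite -sqrf_eq0 eq_le sqr_ge0 andbT.
by rewrite xx sqr_coord_le_dotp.
Qed.

Lemma continuous_dotp (T : topologicalType) (f g : T -> 'cV[R]_k) :
  continuous f -> continuous g -> continuous (fun t => dotp (f t) (g t)).
Proof.
move=> cf cg; apply: continuous_big => [|i _ t]; first exact: add_continuous.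
have c (h : T -> 'cV[R]_k) : continuous h ->
      (h x i ord0) @[x --> t] --> h t i ord0.
  by move=> ch; apply: cvg_comp (ch t) (@coord_continuous _ _ _ i ord0 (h t)).
by apply: cvgM; exact: c.
Qed.

(** Compactness of a product of segments is available for row vectors; transposition is continuous
    and carries it over to columns. *)
Lemma compact_box (M : R) :
  compact [set x : 'cV[R]_k | forall i, `[- M, M]%classic (x i ord0)].
Proof.
have cT : continuous (@trmx R 1 k).
  move=> x B /nbhs_ballP[e e0 eB]; apply/nbhs_ballP; exists e => //= y [_ xy].
  by apply: eB; split => // i j; rewrite !mxE; exact: xy.
rewrite (_ : mkset _ =
    trmx @` [set v : 'rV[R]_k | forall i, `[- M, M]%classic (v ord0 i)]).
  apply: continuous_compact; first exact/continuous_subspaceT.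
  apply: (@rV_compact R k (fun=> `[- M, M]%classic)) => i.
  exact: segment_compact.
apply/seteqP; split => x.
- move=> xM; exists x^T; last by rewrite trmxK.
  by move=> i /=; rewrite mxE; exact: xM.
- by move=> [v vM <-] i; rewrite mxE; exact: vM.
Qed.

End inner_product.

Lemma dotp_mulmx (R : realType) m n (A : 'M[R]_(m, n)) x y :
  dotp (A *m x) y = dotp x (A^T *m y).
Proof.
have dE k (u v : 'cV[R]_k) : dotp u v = (u^T *m v) ord0 ord0.
  by rewrite mxE; apply: eq_bigr => i _; rewrite mxE.
by rewrite !dE trmx_mul mulmxA.
Qed.

(** * Strict separation of a point, and of a segment issuing from 0, from a closed convex set *)

Section separation.
Variables (R : realType) (k : nat).
Implicit Types (x y z p : 'cV[R]_k) (C : set 'cV[R]_k).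

Definition convex_subset C := forall (t : R) x y, 0 < t < 1 ->
  C x -> C y -> C ((1 - t) *: x + t *: y).

(** [C] may be unbounded, but only its points at least as close to [p] as a fixed [x0] compete, and
    these lie in a compact box. *)
Lemma nearest_point C p : closed C -> C !=set0 ->
  exists2 x, C x & forall y, C y -> dotp (x - p) (x - p) <= dotp (y - p) (y - p).
Proof.
move=> clC [x0 Cx0].
pose q x := dotp (x - p) (x - p).
(* The sum bounds each coordinate of [p]. The rest bounds those of [x - p], whose squares are at
   most [q x0], hence at most the square of [1 + q x0]. *)
pose M := \sum_(i < k) `|p i ord0| + (1 + q x0).
have q0 : 0 <= q x0 by exact: dotp_ge0.
pose B := [set x : 'cV[R]_k | forall i, `[- M, M]%classic (x i ord0)].
have inB x : q x <= q x0 -> B x.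
  move=> qx i; have := sqr_coord_le_dotp (x - p) i; rewrite !mxE /q in qx * => h.
  have hp : `|p i ord0| <= \sum_(i < k) `|p i ord0|.
    by rewrite (bigD1 i) //= lerDl sumr_ge0.
  have : `|x i ord0 - p i ord0| <= 1 + q x0.
    have h2 := le_trans h qx; rewrite -/(q x0) in h2.
    rewrite -ler_sqr ?nnegrE ?normr_ge0 ?addr_ge0 // real_normK ?num_real //.
    apply: (le_trans h2); nra.
  rewrite /= in_itv /= -ler_norml => hx; rewrite /M.
  have := ler_normD (p i ord0) (x i ord0 - p i ord0); rewrite addrC subrK => hh.
  by apply: (le_trans hh); exact: lerD.
have cCB : compact (C `&` B).
  by rewrite setIC; apply: compact_closedI => //; exact: compact_box.
have cq : continuous q.
  by apply: continuous_dotp => x; exact: (cvgB cvg_id (cvg_cst p)).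
have [|x + xmin] :=
  compact_EVT_min _ cCB (continuous_subspaceT cq).
  by exists x0; split => //; exact: inB.
rewrite inE => -[Cx Bx]; exists x => // y Cy.
have [yx|/ltW yx] := leP (q y) (q x0).
  by apply: xmin; rewrite inE; split => //; exact: inB.
apply: le_trans yx; apply: xmin; rewrite inE; split => //.
exact: inB.
Qed.

(** The normal is [x0 - p], with [x0] the point of [C] nearest to [p], and the gap is the squared
    distance. *)
Lemma separation C p : closed C -> convex_subset C -> C !=set0 -> ~ C p ->
  exists y, exists2 e, 0 < e & forall x, C x -> dotp p y + e <= dotp x y.
Proof.
move=> clC cvC C0 Cp; have [x0 Cx0 xmin] := nearest_point p clC C0.
exists (x0 - p), (dotp (x0 - p) (x0 - p)).
  by apply: dotp_gt0; rewrite subr_eq0; apply: contra_notN Cp => /eqP <-.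
move=> x Cx; set d := x0 - p; rewrite -dotpDl /d subrKC.
(* First-order condition at [x0]: compare its distance with that of the point at parameter [t] on
   the segment towards [x], expand, and divide by [t]. *)
have key t : 0 < t < 1 -> 0 <= 2 * dotp (x - x0) d + t * dotp (x - x0) (x - x0).
  move=> t01; have := xmin _ (cvC t _ _ t01 Cx0 Cx).
  have -> : (1 - t) *: x0 + t *: x - p = d + t *: (x - x0).
    by apply/colP => i; rewrite !mxE; ring.
  rewrite -/d !(dotpDl d, dotpDr d, dotpDr _ (t *: _), dotpZl, dotpZr).
  rewrite (dotpC d (x - x0)); move/andP: t01 => [t0 _].
  rewrite -subr_ge0 => h; rewrite -(pmulr_rge0 _ t0); lra.
rewrite -subr_ge0 -/d -dotpNl -dotpDl.
apply/ler_addgt0Pr => e e0.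
have N0 := dotp_ge0 (x - x0).
set a := dotp (x - x0) d in key *; set b := dotp (x - x0) (x - x0) in key N0 *.
(* This [t] makes the quadratic term at most [e]; adding 1 keeps the denominator positive when [b]
   is 0, and the cap 1/2 keeps [t] below 1. *)
have t0 : 0 < Num.min (1 / 2) (e / (b + 1)).
  by rewrite lt_min divr_gt0 //= ?divr_gt0 //; lra.
have := key (Num.min (1 / 2) (e / (b + 1))); rewrite t0 gt_min.
have -> : 1 / 2 < 1 :> R by lra.
move=> /(_ isT).
have : Num.min (1 / 2) (e / (b + 1)) * (b + 1) <= e.
  by rewrite -ler_pdivlMr ?ge_min ?lexx ?orbT //; lra.
nra.
Qed.

(** The set is the difference of [C] and the segment from 0 to [u]. Its complement is open by the
    tube lemma: compactness of [0, 1] yields one neighbourhood of [w] valid for all [s]. *)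
Lemma closed_shift C u : closed C ->
  closed [set w | exists2 s, `[0, 1]%classic s & C (w + s *: u)].
Proof.
move=> clC; rewrite -(setCK (mkset _)); apply: open_closedC.
rewrite openE => w /= nw.
have nCnear (s : R) : `[0, 1]%classic s ->
  \forall s' \near s & w' \near w, ~ C (w' + s' *: u).
  move=> s01.
  have cf : continuous (fun z : R * 'cV[R]_k => z.2 + z.1 *: u).
    move=> z; apply: cvgD; first exact: cvg_snd.
    by apply: cvgZr_tmp; exact: cvg_fst.
  have nC : ~ C (w + s *: u) by move=> h; apply: nw; exists s.
  exact: (cf (s, w) _ (open_nbhs_nbhs (conj (closed_openC clC) nC))).
have := (compact_near_coveringP _).1 (@segment_compact R 0 1) _ (nbhs w)
  (fun w' s => ~ C (w' + s *: u)) (nbhs_filter w) nCnear.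
apply: filterS => w' /= h [s s01]; exact: h.
Qed.

Lemma separation_segment C u : closed C -> convex_subset C -> C !=set0 ->
  (forall s, 0 <= s <= 1 -> ~ C (s *: u)) ->
  exists y, dotp u y < 1 /\ forall x, C x -> 1 <= dotp x y.
Proof.
move=> clC cvC [c Cc] nC.
pose D := [set w | exists2 s, `[0, 1]%classic s & C (w + s *: u)].
have cvD : convex_subset D.
  move=> t x y t01 [r r01 Cr] [s s01 Cs].
  exists ((1 - t) * r + t * s).
    move: t01 r01 s01; rewrite /= !in_itv /= => /andP[? ?] /andP[? ?] /andP[? ?].
    apply/andP; split; nra.
  have := cvC t _ _ t01 Cr Cs; congr (C _); apply/colP => i; rewrite !mxE; ring.
have D0 : D !=set0.
  by exists c, 0; rewrite ?scale0r ?addr0 //= in_itv /= lexx ler01.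
have nD0 : ~ D 0.
  by move=> [s]; rewrite /= in_itv /= add0r => /nC.
have [y [e e0]] := separation (@closed_shift C u clC) cvD D0 nD0.
rewrite dotp0l add0r => De.
(* The end [s = 0] of the segment gives the lower bound [e] on [C], the end [s = 1] gives
   [e + dotp u y]. The larger one is positive and exceeds [dotp u y], so dividing [y] by it
   normalises the bound to 1. *)
pose a := Num.max e (e + dotp u y).
have a0 : 0 < a by rewrite lt_max e0.
have Ca x : C x -> a <= dotp x y.
  move=> Cx; rewrite ge_max; apply/andP; split.
    by apply: De; exists 0; rewrite ?scale0r ?addr0 //= in_itv /= lexx ler01.
  rewrite -lerBrDr -dotpNl -dotpDl; apply: De; exists 1.
    by rewrite /= in_itv /= lexx ler01.
  by rewrite scale1r subrK.
exists (a^-1 *: y); split.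
  rewrite dotpZr mulrC ltr_pdivrMr // mul1r lt_max; apply/orP; right; lra.
by move=> x /Ca xa; rewrite dotpZr mulrC ler_pdivlMr // mul1r.
Qed.

End separation.

(** Recession argument: a linear functional bounded above along a ray is nonpositive in the
    direction of that ray. *)
Lemma le0_of_scaled_bound (R : realType) (a c : R) :
  (forall t, 0 < t -> t * a <= c) -> a <= 0.
Proof.
move=> h; rewrite leNgt; apply/negP => a0.
have c0 : 0 < c by rewrite (lt_le_trans a0) // -[a]mul1r h.
have := h (2 * c / a); rewrite divfK ?gt_eqF // divr_gt0 ?mulr_gt0 //.
by move=> /(_ isT); lra.
Qed.

(** * Polars of gauges and the unit-level bipolar theorem *)

Section polarity.
Variables (R : realType) (k : nat) (h : 'cV[R]_k -> \bar R).
Implicit Types x y z v : 'cV[R]_k.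

(** These are the competitors in the infimum defining [polar]; arguing with them avoids any question
    of attainment. *)
Definition polar_bound y (mu : R) :=
  0 < mu /\ forall x, ((dotp x y)%:E <= mu%:E * h x)%E.

Lemma polar_le y mu : polar_bound y mu -> (polar h y <= mu%:E)%E.
Proof. by move=> ymu; apply: ereal_inf_lbound; exists mu. Qed.

Lemma polar_lt y c : (polar h y < c)%E ->
  exists2 mu, polar_bound y mu & (mu%:E < c)%E.
Proof. by move=> /ereal_inf_lt[_ [mu ymu <-] muc]; exists mu. Qed.

Lemma polar_ge0 y : (0 <= polar h y)%E.
Proof. by apply: le_ereal_inf_tmp => _ [mu [mu0 _] <-]; rewrite lee_fin ltW. Qed.

Lemma polar_bound_le x y (mu r : R) :
  polar_bound y mu -> (h x <= r%:E)%E -> dotp x y <= mu * r.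
Proof.
move=> [mu0 ymu] xr; rewrite -lee_fin; apply: le_trans (ymu x) _.
by rewrite EFinM lee_pmul2l // lte_fin.
Qed.

Lemma dotp_le_polar x y : (h x <= 1%:E)%E -> ((dotp x y)%:E <= polar h y)%E.
Proof.
move=> x1; apply: le_ereal_inf_tmp => _ [mu ymu <-].
by rewrite lee_fin -[mu]mulr1; exact: polar_bound_le x1.
Qed.

Lemma polar_boundZ (t : R) y mu :
  0 < t -> polar_bound y mu -> polar_bound (t *: y) (t * mu).
Proof.
move=> t0 [mu0 ymu]; split; first exact: mulr_gt0.
move=> x; rewrite dotpZr !EFinM -muleA lee_pmul2l //; exact: ymu.
Qed.

Lemma polar_boundD y y' mu mu' :
  polar_bound y mu -> polar_bound y' mu' -> polar_bound (y + y') (mu + mu').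
Proof.
move=> [mu0 ymu] [mu0' ymu']; split; first exact: addr_gt0.
move=> x; rewrite dotpDr !EFinD ge0_muleDl ?lee_fin ?(ltW mu0) ?(ltW mu0') //.
exact: leeD.
Qed.

Hypothesis gh : gauge h.

Lemma polar_bound0 mu : 0 < mu -> polar_bound 0 mu.
Proof.
move=> mu0; split=> // x.
by rewrite dotp0r mule_ge0 ?lee_fin ?(ltW mu0) //; exact: gauge_ge0.
Qed.

Lemma polar0 : polar h 0 = 0%E.
Proof.
apply/eqP; rewrite eq_le polar_ge0 andbT; apply/lee_addgt0Pr => e e0.
by rewrite add0e; exact/polar_le/polar_bound0.
Qed.

Lemma gauge_le_scale (t r : R) x :
  0 < t -> (h x <= r%:E)%E -> (h (t *: x) <= (t * r)%:E)%E.
Proof.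
by move=> t0 xr; rewrite gauge_homogeneous // EFinM lee_pmul2l // lte_fin.
Qed.

(** By homogeneity one sublevel set decides. A point of finite positive value is rescaled to value
    [s]; a point of value 0 has its whole ray in the sublevel set, which forces a nonpositive
    product. *)
Lemma polar_bound_of_sublevel v (s mu : R) : 0 < s -> 0 < mu ->
  (forall x, (h x <= s%:E)%E -> dotp x v <= mu * s) -> polar_bound v mu.
Proof.
move=> s0 mu0 hs; split => // x.
have := gauge_ge0 gh x; case E : (h x) => [r||] //; last first.
  by move=> _; rewrite gt0_muley ?leey // lte_fin.
rewrite lee_fin -EFinM lee_fin le_eqVlt => /predU1P[r0|r0].
  rewrite -r0 mulr0; apply: (@le0_of_scaled_bound _ _ (mu * s)) => t t0.
  rewrite -dotpZl; apply: hs; rewrite gauge_homogeneous // E -r0 mule0.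
  by rewrite lee_fin ltW.
have := hs ((s / r) *: x); rewrite gauge_homogeneous ?divr_gt0 // E -EFinM.
rewrite divfK ?gt_eqF // dotpZl => /(_ (lexx _)).
by rewrite mulrAC ler_pdivrMr // mulrAC mulrC ler_pM2r.
Qed.

Lemma convex_gauge_sublevel (s : R) : 0 <= s ->
  convex_subset [set x | (h x <= s%:E)%E].
Proof.
move=> s0 t x y t01 xs ys; apply: le_trans (gauge_convex gh x y t01) _.
case/andP: t01 => t0 t1.
have -> : s%:E = ((1 - t)%:E * s%:E + t%:E * s%:E)%E.
  by rewrite -!EFinM -EFinD; congr EFin; ring.
by apply: leeD; apply: lee_wpmul2l => //; rewrite lee_fin; lra.
Qed.

Hypothesis lsch : lower_semicontinuous h.

Lemma closed_gauge_sublevel (s : R) : closed [set x | (h x <= s%:E)%E].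
Proof.
rewrite (_ : mkset _ = ~` [set x | (s%:E < h x)%E]).
  by apply: open_closedC; exact: (lower_semicontinuousP h).1.
by apply/seteqP; split => x /=; rewrite leNgt => /negP.
Qed.

(** Otherwise [z] is separated from the closed convex unit sublevel set, and the negated normal
    violates the assumption. *)
Lemma bipolar_le1 z :
  (forall v mu, polar_bound v mu -> dotp z v <= mu) -> (h z <= 1%:E)%E.
Proof.
move=> zle; apply: contrapT => nz.
have h0 : (h 0 <= 1%:E)%E by rewrite (gauge0 gh) lee_fin.
have [|y [e e0 ye]] := separation (@closed_gauge_sublevel 1)
  (convex_gauge_sublevel ler01) _ nz; first by exists 0.
have := ye 0 h0; rewrite dotp0l => zy.
have vmu : polar_bound (- y) (- dotp z y - e / 2).
  apply: (@polar_bound_of_sublevel _ 1) => //; first lra.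
  by move=> x /ye; rewrite dotpNr mulr1; lra.
by have := zle _ _ vmu; rewrite dotpNr; lra.
Qed.

End polarity.

Section dual_feasible_set.
Variables (R : realType) (m : nat) (rho : 'cV[R]_m -> \bar R) (b : 'cV[R]_m).
Variable sigma : R.
Hypotheses (grho : gauge rho) (lscrho : lower_semicontinuous rho).
Hypothesis sigma_ge0 : 0 <= sigma.

Lemma Fp_b : Fp rho b sigma b.
Proof. by rewrite /Fp /= subrr gauge0 // lee_fin. Qed.

Lemma closed_Fp : closed (Fp rho b sigma).
Proof.
rewrite (_ : Fp _ _ _ = (fun u => b - u) @^-1` [set x | (rho x <= sigma%:E)%E]) //.
have cf : continuous (fun u : 'cV[R]_m => b - u).
  move=> u.
  exact: (@cvgB _ _ _ (nbhs u) _ (fun=> b) id _ _ (cvg_cst b) cvg_id).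
apply: ((continuous_closedP _).1 cf).
exact: (@closed_gauge_sublevel _ _ _ lscrho sigma).
Qed.

Lemma convex_Fp : convex_subset (Fp rho b sigma).
Proof.
move=> t x y t01 Fx Fy; rewrite /Fp /=.
have -> : b - ((1 - t) *: x + t *: y) = (1 - t) *: (b - x) + t *: (b - y).
  by apply/colP => i; rewrite !mxE; ring.
exact: (convex_gauge_sublevel grho sigma_ge0).
Qed.

Lemma Fd_le y :
  Fd rho b sigma y <-> (scaled_polar sigma rho y <= (dotp b y - 1)%:E)%E.
Proof.
rewrite /Fd /=; case: (scaled_polar sigma rho y) => [r||].
- by rewrite -EFinD !lee_fin; split; lra.
- by rewrite /= addeNy leeNy_eq leye_eq.
- by rewrite /= addey // leey leNye.
Qed.

Lemma closure_dom_polar_convex : convex_subset (closure (dom (polar rho))).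
Proof.
have cl t (x y : 'cV[R]_m) : 0 < t < 1 -> dom (polar rho) x ->
    dom (polar rho) y ->
    dom (polar rho) ((1 - t) *: x + t *: y).
  case/andP => t0 t1 /polar_lt[mu xmu _] /polar_lt[nu ynu _].
  have s0 : 0 < 1 - t by lra.
  have := polar_boundD (polar_boundZ s0 xmu) (polar_boundZ t0 ynu).
  by move=> /polar_le h; rewrite /dom /= (le_lt_trans h) // ltry.
move=> t x y t01 Cx Cy B.
have cf : continuous (fun p : 'cV[R]_m * 'cV[R]_m => (1 - t) *: p.1 + t *: p.2).
  move=> p; apply: cvgD; apply: cvgZl_tmp; [exact: cvg_fst|exact: cvg_snd].
move=> /(cf (x, y))[[U V] /= [nU nV] UV].
have [x' [Cx' Ux']] := Cx _ nU; have [y' [Cy' Vy']] := Cy _ nV.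
exists ((1 - t) *: x' + t *: y'); split; first exact: cl.
exact: (UV (x', y')).
Qed.

Lemma closure_dom_polar y : closure (dom (polar rho)) y <->
  forall x, (rho x <= 0)%E -> dotp x y <= 0.
Proof.
split=> [Cy x x0|y0].
  have sub : dom (polar rho) `<=` [set v | dotp x v <= 0].
    by move=> v /polar_lt[mu vmu _] /=; rewrite -(mulr0 mu); exact: polar_bound_le x0.
  have cl : closed [set v | dotp x v <= 0].
    have cf : continuous (dotp x).
      apply: (@continuous_dotp R m _ (fun=> x) id); last by move=> w; exact: cvg_id.
      exact: cst_continuous.
    exact: ((continuous_closedP _).1 cf _ (@closed_le R 0)).
  by have := closureS sub Cy; rewrite -((closure_id _).1 cl).
apply: contrapT => nCy.
have dom0 : dom (polar rho) 0 by rewrite /dom /= polar0 // ltry.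
have [|v [e e0 ve]] := separation (@closed_closure _ _)
  closure_dom_polar_convex _ nCy.
  by exists 0; exact: subset_closure.
have ev := ve 0 (subset_closure dom0); rewrite dotp0l in ev.
have v0 w mu : polar_bound rho w mu -> dotp (- v) w <= 0.
  move=> wmu; apply: (@le0_of_scaled_bound _ _ (- (dotp y v + e))) => t t0.
  have : closure (dom (polar rho)) (t *: w).
    apply: subset_closure; rewrite /dom /=.
    by rewrite (le_lt_trans (polar_le (polar_boundZ t0 wmu))) // ltry.
  by move=> /ve; rewrite dotpNl dotpZl (dotpC w); lra.
have rv : (rho (- v) <= 0)%E.
  apply/lee_addgt0Pr => d d0; rewrite add0e.
  have ie : 0 < d^-1 by rewrite invr_gt0.
  have : (rho (d^-1 *: - v) <= 1%:E)%E.
    apply: bipolar_le1 => // w mu wmu; rewrite dotpZl.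
    apply: (@le_trans _ _ 0); first by rewrite pmulr_rle0 //; exact: v0 wmu.
    by case: wmu => /ltW.
  by move=> /(gauge_le_scale grho d0); rewrite scalerA divff ?gt_eqF // scale1r mulr1.
by have := y0 _ rv; rewrite dotpNl dotpC; lra.
Qed.

Lemma Fd_antipolar y :
  Fd rho b sigma y <-> forall u, Fp rho b sigma u -> 1 <= dotp u y.
Proof.
rewrite Fd_le /scaled_polar; have [s0|s0] := eqVneq sigma 0.
  rewrite /indicator; case: asboolP => [Cy|nCy]; split=> //.
  - rewrite lee_fin => b1 u; rewrite /Fp /= s0 => /((closure_dom_polar y).1 Cy).
    by rewrite dotpDl dotpNl; lra.
  - by move=> /(_ _ Fp_b); rewrite lee_fin; lra.
  - move=> h; exfalso; apply: nCy; apply/closure_dom_polar => x x0.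
    apply: (@le0_of_scaled_bound _ _ (dotp b y - 1)) => t t0.
    have : Fp rho b sigma (b - t *: x).
      rewrite /Fp /= opprB addrC subrK s0.
      by rewrite -(mulr0 t); exact: gauge_le_scale.
    by move=> /h; rewrite dotpDl dotpNl dotpZl; lra.
have sp : 0 < sigma by rewrite lt_neqAle eq_sym s0.
have si : 0 < sigma^-1 by rewrite invr_gt0.
split.
- move=> h u /(gauge_le_scale grho si); rewrite mulVf // => /(dotp_le_polar y).
  rewrite dotpZl -(lee_pmul2l _ (_ : 0 < sigma%:E)%E) ?lte_fin //.
  move=> h1; have := le_trans h1 h; rewrite -EFinM lee_fin mulrA divff // mul1r.
  by rewrite dotpDl dotpNl; lra.
- move=> h; have b1 := h _ Fp_b.
  suff : (polar rho y <= ((dotp b y - 1) / sigma)%:E)%E.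
    rewrite -(lee_pmul2l _ (_ : 0 < sigma%:E)%E) ?lte_fin // -EFinM.
    by rewrite mulrC divfK.
  apply/lee_addgt0Pr => e e0; rewrite -EFinD; apply: polar_le.
  have d0 : 0 <= (dotp b y - 1) / sigma by rewrite divr_ge0 //; lra.
  apply: (@polar_bound_of_sublevel _ _ _ grho _ sigma) => //; first lra.
  move=> x xs; have : Fp rho b sigma (b - x) by rewrite /Fp /= opprB addrC subrK.
  move=> /h; rewrite dotpDl dotpNl mulrDl divfK //.
  by have := mulr_gt0 e0 sp; lra.
Qed.

(* No closure is needed: the segment from 0 to [u] is compact, and separating
   it from [Fp] gives a positive bound because the segment contains 0. *)
Lemma Fd_antipolar_shrink u : (sigma%:E < rho b)%E ->
  (forall y, Fd rho b sigma y -> 1 <= dotp u y) ->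
  exists s, 0 < s <= 1 /\ Fp rho b sigma (s *: u).
Proof.
move=> rb uF; apply: contrapT => nex.
have [||y [uy yF]] := separation_segment (u := u) closed_Fp convex_Fp.
- by exists b; exact: Fp_b.
- move=> s /andP[]; rewrite le_eqVlt => /predU1P[<- _|s0 s1 Fs].
    by rewrite scale0r /Fp /= subr0 leNgt rb.
  by apply: nex; exists s; rewrite s0 s1.
by have := uF y ((Fd_antipolar y).2 yF); rewrite leNgt uy.
Qed.

End dual_feasible_set.

Section lagrange_dual.
Variables (R : realType) (m n : nat).
Variables (kappa : 'cV[R]_n -> \bar R) (rho : 'cV[R]_m -> \bar R).
Variables (A : 'M[R]_(m, n)) (b : 'cV[R]_m) (sigma : R).
Hypotheses (gkappa : gauge kappa) (lsckappa : lower_semicontinuous kappa).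
Hypothesis Fd0 : Fd rho b sigma !=set0.

Lemma Lp_objective_geP z (l : R) :
  (l%:E <= Lp_objective kappa rho A b sigma z)%E <->
  (kappa z <= 1%:E)%E /\ forall y, Fd rho b sigma y -> l <= dotp (A *m z) y.
Proof.
have -> : (l%:E <= Lp_objective kappa rho A b sigma z)%E <->
  forall y w, ((dotp z w)%:E - Gd_perturbation kappa rho A b sigma y w
    <= (- l)%:E)%E.
  rewrite /Lp_objective leeNr -EFinN; split=> [h y w|h].
    apply: le_trans h; apply: ereal_sup_ubound; exists (y, w) => //=.
    by rewrite dotp0l add0r.
  by apply: ge_ereal_sup => _ [[y w] _ <-] /=; rewrite dotp0l add0r.
split=> [h|[z1 lz] y w].
  have hd y w mu : Fd rho b sigma y -> polar_bound kappa (A^T *m y + w) mu ->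
      dotp z w - mu <= - l.
    move=> Fy wmu; rewrite -lee_fin; apply: le_trans (h y w).
    rewrite /Gd_perturbation /indicator asboolT // adde0 EFinB leeB //.
    exact: polar_le.
  split.
  - have [y Fy] := Fd0; apply: (bipolar_le1 gkappa lsckappa) => v mu vmu.
    rewrite -subr_le0; apply: (@le0_of_scaled_bound _ _ (dotp (A *m z) y - l)).
    move=> t t0; have := hd y (t *: v - A^T *m y) (t * mu) Fy.
    rewrite subrKC => /(_ (polar_boundZ t0 vmu)).
    by rewrite dotpDr dotpNr dotpZr -dotp_mulmx; lra.
  - move=> y Fy; apply/ler_addgt0Pr => e e0.
    have := hd y (- (A^T *m y)) e Fy; rewrite subrr => /(_ (polar_bound0 gkappa e0)).
    by rewrite dotpNr -dotp_mulmx; lra.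
rewrite /Gd_perturbation /indicator; case: asboolP => Fy; last first.
  rewrite addey ?addeNy ?leNye //.
  by apply: contraTneq (polar_ge0 kappa (A^T *m y + w)) => ->.
have := dotp_le_polar (A^T *m y + w) z1; rewrite adde0.
case: (polar kappa _) => [r||] //; last by rewrite addeNy leNye.
rewrite -EFinB !lee_fin dotpDr -dotp_mulmx; have := lz _ Fy; lra.
Qed.

End lagrange_dual.

Section gauge_duality.
Variables (R : realType) (m n : nat).
Variables (kappa : 'cV[R]_n -> \bar R) (rho : 'cV[R]_m -> \bar R).
Variables (A : 'M[R]_(m, n)) (b : 'cV[R]_m) (sigma : R).
Hypotheses (gkappa : gauge kappa) (lsckappa : lower_semicontinuous kappa).
Hypotheses (grho : gauge rho) (lscrho : lower_semicontinuous rho).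
Hypotheses (sigma_ge0 : 0 <= sigma) (rho_b : (sigma%:E < rho b)%E).
Hypothesis Gd_feas :
  exists2 y, Fd rho b sigma y & dom (polar kappa) (A^T *m y).

Local Notation obj := (Lp_objective kappa rho A b sigma).
Local Notation feasible := (Gp_feasible_set kappa rho A b sigma).

Let Fd0 : Fd rho b sigma !=set0.
Proof. by have [y Fy _] := Gd_feas; exists y. Qed.

Lemma Gp_value_gt0 :
  exists2 c, 0 < c & forall x, feasible x -> (c%:E <= kappa x)%E.
Proof.
have [y Fy /polar_lt[mu ymu _]] := Gd_feas; have [mu0 _] := ymu.
exists mu^-1; first by rewrite invr_gt0.
move=> x [Fx xdom]; have := gauge_ge0 gkappa x; move: xdom; rewrite /dom /=.
case E : (kappa x) => [k||] // _ k0; rewrite lee_fin -[leLHS]mul1r ler_pdivrMr //.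
rewrite mulrC; apply: le_trans (_ : dotp x (A^T *m y) <= _).
  rewrite -dotp_mulmx; exact: ((Fd_antipolar b grho lscrho sigma_ge0 y).1 Fy).
by apply: polar_bound_le ymu _; rewrite E.
Qed.

Lemma Lp_objective_of_feasible x (k : R) : 0 < k -> feasible x ->
  (kappa x <= k%:E)%E -> ((k^-1)%:E <= obj (k^-1 *: x))%E.
Proof.
move=> k0 [Fx _] xk; have ki : 0 < k^-1 by rewrite invr_gt0.
apply/(Lp_objective_geP A gkappa lsckappa Fd0); split.
  by have := gauge_le_scale gkappa ki xk; rewrite mulVf // gt_eqF.
move=> y Fy; rewrite -scalemxAr dotpZl ler_pMr //.
exact: ((Fd_antipolar b grho lscrho sigma_ge0 y).1 Fy).
Qed.

Lemma feasible_of_Lp_objective z (l : R) : 0 < l -> (l%:E <= obj z)%E ->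
  exists s, [/\ 0 < s <= 1, feasible ((s / l) *: z)
              & (kappa ((s / l) *: z) <= (s / l)%:E)%E].
Proof.
move=> l0 /(Lp_objective_geP A gkappa lsckappa Fd0)[z1 lz].
have [|s [s01 Fs]] := Fd_antipolar_shrink (u := l^-1 *: (A *m z))
  grho lscrho sigma_ge0 rho_b.
  by move=> y /lz; rewrite dotpZl mulrC ler_pdivlMr // mul1r.
have sl : 0 < s / l by case/andP: s01 => s0 _; rewrite divr_gt0.
have ksl : (kappa ((s / l) *: z) <= (s / l)%:E)%E.
  by have := gauge_le_scale gkappa sl z1; rewrite mulr1.
exists s; split => //; split; last by rewrite /dom /= (le_lt_trans ksl) // ltry.
by rewrite /= -scalemxAr -scalerA.
Qed.

End gauge_duality.

(* Under these hypotheses the value of the Lagrange dual is a positive real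
   number, so [fine] loses nothing and the inverse is a genuine one. *)
Theorem theorem3p9 (R : realType) (m n : nat)
    (kappa : 'cV[R]_n -> \bar R) (rho : 'cV[R]_m -> \bar R)
    (A : 'M[R]_(m, n)) (b : 'cV[R]_m) (sigma : R)
    (kappa_gauge : closed_gauge kappa) (rho_gauge : closed_gauge rho)
    (sigma_ge0 : 0 <= sigma) (rho_b : (sigma%:E < rho b)%E)
    (Gd_feas : Gd_relatively_strictly_feasible kappa rho A b sigma)
    (Gp_feas : Gp_feasible kappa rho A b sigma) (z : 'cV[R]_n) :
  Lp_optimal kappa rho A b sigma z <->
  Gp_optimal kappa rho A b sigma
    ((fine (Lp_value kappa rho A b sigma))^-1 *: z).
Proof.
case: kappa_gauge rho_gauge => gk lk [gr lr].
have Gdf : exists2 y, Fd rho b sigma y & dom (polar kappa) (A^T *m y).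
  by have [_ [[y [Fy _] <-] [yd _]]] := Gd_feas; exists y.
have Fd0 : Fd rho b sigma !=set0 by have [y Fy _] := Gdf; exists y.
set obj := Lp_objective kappa rho A b sigma.
set feas := Gp_feasible_set kappa rho A b sigma.
set nu := Lp_value kappa rho A b sigma.
have [c c0 cP] := Gp_value_gt0 gk gr lr sigma_ge0 Gdf.
have ge_nu z' : (obj z' <= nu)%E by apply: ereal_sup_ubound; exists z'.
have of_feas := Lp_objective_of_feasible gk lk gr lr sigma_ge0 Gdf.
have to_feas := feasible_of_Lp_objective gk lk gr lr sigma_ge0 rho_b Gdf.
have nu_le (d : R) : 0 < d ->
    (forall z' (l : R), 0 < l -> (l%:E <= obj z')%E -> l <= d) -> (nu <= d%:E)%E.
  move=> d0 dP; apply: ge_ereal_sup => _ [z' _ <-]; rewrite leNgt; apply/negP.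
  have := dP z'; rewrite -/obj; case: (obj z') => [r||] //.
    by rewrite lte_fin => h dr; have := h r (lt_trans d0 dr) (lexx _); lra.
  by move=> /(_ (d + 1)); rewrite leey => h _; have := h ltac:(lra) isT; lra.
have [v nuE v0] : exists2 v : R, nu = v%:E & 0 < v.
  have hi : (nu <= (c^-1)%:E)%E.
    apply: nu_le => [|z' l l0 /(to_feas _ _ l0)[s [/andP[s0 s1] Fs ks]]].
      by rewrite invr_gt0.
    have := le_trans (cP _ Fs) ks; rewrite lee_fin ler_pdivlMr //.
    by rewrite -[c^-1]mul1r ler_pdivlMr // mulrC; lra.
  have [x0 Fx0] := Gp_feas; have [_ x0d] := Fx0.
  have := cP _ Fx0; move: x0d; rewrite /dom /=.
  case E : (kappa x0) => [k||] // _; rewrite lee_fin => ck.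
  have k0 : 0 < k by lra.
  have lo : ((k^-1)%:E <= nu)%E.
    by apply: le_trans (ge_nu _); apply: of_feas Fx0 _; rewrite ?E.
  move: hi lo; case: (nu) => [v||] // _; rewrite lee_fin => kv.
  by exists v => //; apply: lt_le_trans kv; rewrite invr_gt0.
rewrite nuE /=.
have feas_ge x : feas x -> ((v^-1)%:E <= kappa x)%E.
  move=> Fx; have [_ xd] := Fx; have := cP _ Fx; move: xd; rewrite /dom /=.
  case E : (kappa x) => [k||] // _; rewrite !lee_fin => ck.
  have k0 : 0 < k by lra.
  have : ((k^-1)%:E <= nu)%E.
    by apply: le_trans (ge_nu _); apply: of_feas Fx _; rewrite ?E.
  by rewrite nuE lee_fin -[leRHS]invrK lef_pV2 // posrE invr_gt0.
split=> [[oz zmax]|[Fz zmin]].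
- have onu : obj z = nu.
    by apply/eqP; rewrite eq_le ge_nu; apply: ge_ereal_sup => _ [z' _ <-]; exact: zmax.
  have [|s [/andP[s0 s1] Fs ks]] := to_feas z v v0; first by rewrite -/obj onu nuE.
  have s_eq1 : s = 1.
    apply/eqP; rewrite eq_le s1; have := le_trans (feas_ge _ Fs) ks.
    by rewrite lee_fin -[leLHS]mul1r ler_pM2r // invr_gt0.
  rewrite s_eq1 mul1r in Fs ks; split => // x' Fx'.
  exact: le_trans ks (feas_ge _ Fx').
- have kz : (kappa (v^-1 *: z) <= (v^-1)%:E)%E.
    have := feas_ge _ Fz; have [_ zd] := Fz; move: zd; rewrite /dom /=.
    case E : (kappa (v^-1 *: z)) => [k||] // _; rewrite !lee_fin => vk.
    have k0 : 0 < k by apply: lt_le_trans vk; rewrite invr_gt0.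
    suff : (nu <= (k^-1)%:E)%E.
      by rewrite nuE lee_fin -[leLHS]invrK lef_pV2 // posrE invr_gt0.
    apply: nu_le => [|z' l l0 /(to_feas _ _ l0)[s [/andP[s0 s1] Fs ks]]].
      by rewrite invr_gt0.
    have := le_trans (zmin _ Fs) ks; rewrite E lee_fin ler_pdivlMr //.
    by rewrite -[k^-1]mul1r ler_pdivlMr // mulrC; lra.
  have vi : 0 < v^-1 by rewrite invr_gt0.
  have := of_feas _ _ vi Fz kz; rewrite invrK scalerA divff ?gt_eqF // scale1r.
  rewrite -/obj -nuE => oz; split; first by apply: lt_le_trans oz; rewrite nuE ltNyr.
  by move=> z'; exact: le_trans (ge_nu _) oz.
Qed.
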